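(* Let $\Gamma=\{0,1,A\}$ be an alphabet having three letters, and let $\alpha\in\Gamma^\omega$ be the $\omega$-word defined by $$\alpha = A.0.A.0^2.A.0^3.A.0^4.A.0^5.A \ldots A.0^n.A.0^{n+1}.A \ldots$$ Then there exists an infinitary rational relation $R\subseteq \Gamma^\omega\times\Gamma^\omega$ such that: (1) $R_\alpha=\{\sigma\in\Gamma^\omega \mid (\sigma,\alpha)\in R\}$ is a $\mathbf{\Pi}^0_3$-complete subset of $\Gamma^\omega$; (2) for all $u\in\Gamma^\omega-\{\alpha\}$, $R_u=\{\sigma\in\Gamma^\omega\mid(\sigma,u)\in R\}=\Gamma^\omega$; (3) moreover, $R$ is a $\mathbf{\Pi}^0_3$-complete subset of $\Gamma^\omega\times\Gamma^\omega$.
   Context: For a finite alphabet $X$, $X^\star$ is the set of finite words over $X$ (including the empty word $\lambda$) and $X^\omega$ is the set of infinite words $a_1a_2a_3\ldots$ indexed by integers $\geq 1$. Concatenation is written $u.v$ or $uv$, and $0^n$ is the word consisting of $n$ letters $0$. A 2-tape Büchi automaton is a tuple $\mathcal{T}=(K,\Sigma_1,\Sigma_2,\Delta,q_0,F)$, where $K$ is a finite set of states, $\Sigma_1,\Sigma_2$ are finite alphabets, $\Delta$ is a finite subset of $K\times\Sigma_1^\star\times\Sigma_2^\star\times K$ (transitions), $q_0\in K$ is the initial state and $F\subseteq K$ is the set of accepting states. A computation of $\mathcal{T}$ over $(u,v)\in\Sigma_1^\omega\times\Sigma_2^\omega$ is an infinite sequence of transitions $(q_0,u_1,v_1,q_1),(q_1,u_2,v_2,q_2),\ldots,(q_{i-1},u_i,v_i,q_i),\ldots$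 in $\Delta$ such that $u=u_1.u_2.u_3\ldots$ and $v=v_1.v_2.v_3\ldots$. It is successful iff there are $q_f\in F$ and infinitely many $i\geq 0$ with $q_i=q_f$. The relation $R(\mathcal{T})\subseteq\Sigma_1^\omega\times\Sigma_2^\omega$ accepted by $\mathcal{T}$ is the set of pairs $(u,v)$ over which $\mathcal{T}$ has some successful computation. A subset of $\Sigma_1^\omega\times\Sigma_2^\omega$ is an infinitary rational relation iff it equals $R(\mathcal{T})$ for some 2-tape Büchi automaton $\mathcal{T}$. $X^\omega$ carries the Cantor topology (the product topology of the discrete topology on $X$): open sets are the sets $W.X^\omega$ with $W\subseteq X^\star$. The space $\Gamma^\omega\times\Gamma^\omega$ carries the product topology; equivalently it is identified with $(\Gamma\times\Gamma)^\omega$. $\mathbf{\Sigma}^0_1$ is the class of open sets, $\mathbf{\Pi}^0_1$ the class of closed sets, and for $n\geq1$, $\mathbf{\Sigma}^0_{n+1}$ (resp. $\mathbf{\Pi}^0_{n+1}$) is the class of countable unions of $\mathbf{\Pi}^0_n$-sets (resp. countable intersections of $\mathbf{\Sigma}^0_n$-sets). A subset $S$ of one of these spaces $Z$ is $\mathbf{\Pi}^0_3$-complete iff for every finite alphabet $Y$ and every $E\subseteq Y^\omega$: $E$ is a $\mathbf{\Pi}^0_3$-subset of $Y^\omega$ iff there is a continuous function $f:Y^\omega\to Z$ with $E=f^{-1}(S)$. *)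

(* Defs.v *)
From HB Require Import structures.
From mathcomp Require Import all_boot finmap.
From mathcomp Require Import all_classical topology.

Set Implicit Arguments.
Unset Strict Implicit.
Unset Printing Implicit Defensive.

Local Open Scope classical_set_scope.

(* Infinite words over X, with the product of the discrete topologies.
   Words are indexed from 0: the letter a_(i+1) of a_1 a_2 a_3 ... is u i. *)
Definition omega_word (X : finType) : Type :=
  {ptws nat -> discrete_topology X}.

HB.instance Definition _ (X : finType) := Topological.on (omega_word X).

Section Concatenation.
Context {X : finType}.
Implicit Types (w : nat -> seq X) (u : omega_word X).

Definition concat_upto w n : seq X := flatten [seq w i | i <- iota 0 n].

(* u = w 0 . w 1 . w 2 ...  The factors may be empty, so that the second
   clause is needed to make the concatenation an infinite word. *)
Definition is_omega_concat w u : Prop :=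
  (forall n, concat_upto w n = mkseq u (size (concat_upto w n))) /\
  (forall m, exists n, m <= size (concat_upto w n)).

End Concatenation.

Record buchi2 (S1 S2 : finType) := Buchi2 {
  state : finType;
  transitions : {fset state * seq S1 * seq S2 * state};
  initial : state;
  accepting : {set state} }.

Section Acceptance.
Context {S1 S2 : finType}.
Implicit Type T : buchi2 S1 S2.

(* The i-th transition is (q i, us i, vs i, q i.+1). *)
Definition computation T (u : omega_word S1) (v : omega_word S2)
    (q : nat -> state T) (us : nat -> seq S1) (vs : nat -> seq S2) : Prop :=
  [/\ q 0 = initial T,
      forall i, (q i, us i, vs i, q i.+1) \in transitions T,
      is_omega_concat us u
    & is_omega_concat vs v].

Definition successful T (q : nat -> state T) : Prop :=
  exists2 qf, qf \in accepting T & forall m, exists2 i, m <= i & q i = qf.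

Definition accepted T : set (omega_word S1 * omega_word S2) :=
  [set uv | exists q us vs,
    @computation T uv.1 uv.2 q us vs /\ successful q].

Definition infinitary_rational (R : set (omega_word S1 * omega_word S2)) :=
  exists T : buchi2 S1 S2, R = accepted T.

End Acceptance.

Section BorelHierarchy.
Context {Z : topologicalType}.

(* The classes are indexed by n >= 1; the value at 0 is irrelevant. *)
Fixpoint Sigma0 (n : nat) : set (set Z) :=
  if n is m.+1 then
    if m is 0 then [set A | open A] else
      [set A | exists2 F : nat -> set Z,
        forall i, Pi0 m (F i) & A = \bigcup_i F i]
  else set0
with Pi0 (n : nat) : set (set Z) :=
  if n is m.+1 then
    if m is 0 then [set A | closed A] else
      [set A | exists2 F : nat -> set Z,
        forall i, Sigma0 m (F i) & A = \bigcap_i F i]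
  else set0.

End BorelHierarchy.

Definition Pi0_complete (n : nat) (Z : topologicalType) (S : set Z) : Prop :=
  forall (Y : finType) (E : set (omega_word Y)),
    Pi0 n E <->
    exists2 f : omega_word Y -> Z, continuous f & E = f @^-1` S.

Inductive Gamma := L0 | L1 | LA.

Definition Gamma_to_ord (x : Gamma) : 'I_3 :=
  match x with L0 => inord 0 | L1 => inord 1 | LA => inord 2 end.

Definition ord_to_Gamma (i : 'I_3) : Gamma :=
  match val i with 0 => L0 | 1 => L1 | _ => LA end.

Lemma Gamma_to_ordK : cancel Gamma_to_ord ord_to_Gamma.
Proof. by case; rewrite /ord_to_Gamma /= inordK. Qed.

HB.instance Definition _ := Finite.copy Gamma (can_type Gamma_to_ordK).

Definition alpha_block (n : nat) : seq Gamma := LA :: nseq n.+1 L0.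

(* The first p + 1 blocks A.0.A.0^2 ... A.0^(p+1) have more than p letters, so
   that the default value of nth is never used. *)
Definition alpha : omega_word Gamma :=
  fun p => nth L0 (concat_upto alpha_block p.+1) p.

Lemma leq_size_alpha_block n : n <= size (concat_upto alpha_block n).
Proof.
rewrite /concat_upto; elim: n => // n IHn.
rewrite -addn1 iotaD map_cat flatten_cat size_cat leq_add //.
Qed.

Lemma alphaE : is_omega_concat alpha_block alpha.
Proof.
split=> [n|m]; last by exists m; exact: leq_size_alpha_block.
have pre a b x : x < size (concat_upto alpha_block a) ->
    nth L0 (concat_upto alpha_block (a + b)) x =
    nth L0 (concat_upto alpha_block a) x.
  by move=> xa; rewrite /concat_upto iotaD map_cat flatten_cat nth_cat xa.
apply: (@eq_from_nth _ L0) => [|i ilt]; first by rewrite size_mkseq.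
rewrite nth_mkseq // /alpha -(pre n i.+1 i ilt) addnC pre //.
exact: leq_trans (leq_size_alpha_block i.+1).
Qed.

(* Main.v *)
(* Call the letters of s at the positions strictly between the i-th and the
   (i+1)-st A of alpha row i; it has i+1 cells.  The relation R contains (s, u)
   unless u = alpha and s has its A's exactly where alpha does; in that case
   (s, u) is in R iff every column of s has finitely many nonzero cells.

   A deviation from "u = alpha and s aligned with alpha" is always visible at a
   finite time: either exactly one of s, u has an A at some position, or u does
   not start with A0A, or u contains a 1, or the A's of s and u agree but some
   row is not one letter longer than the preceding one.  For the last test the
   head on s moves one row ahead of the head on u, and the two rows are compared
   letter by letter.

   For the columns, the head on s runs a lag l ahead of the head on u.  While the
   head on s is in the first l - 1 cells of row i, the head on u is still in row
   i - 1, and there the automaton only accepts zeros.  The lag may be increased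
   by one at the beginning of a row, and the Buchi condition asks for infinitely
   many increases; hence every column vanishes eventually.

   Conversely, a Pi^0_3 set is the set of y such that for all j, y is in the
   union over m of closed sets G j m.  Cell j of row i is nonzero iff the least m
   for which the prefix of y of length i extends to a point of G j m changes
   between i and i + 1. *)
From HB Require Import structures.
Require Import Defs.
From mathcomp Require Import all_boot finmap all_classical topology zify.

Set Implicit Arguments.
Unset Strict Implicit.
Unset Printing Implicit Defensive.

Local Open Scope classical_set_scope.

(** * Neighbourhoods, closed sets and continuity in terms of prefixes *)

Section Topology.
Context {X : finType}.
Implicit Types (y z : omega_word X) (C : set (omega_word X)).

Definition agree n y z : Prop := forall k, k < n -> z k = y k.

Definition cylinder y n : set (omega_word X) := agree n y.

Lemma agree_leq m n y z : m <= n -> agree n y z -> agree m y z.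
Proof. by move=> mn yz k km; apply: yz; exact: leq_trans mn. Qed.

Lemma nbhs_cylinder y n : nbhs y (cylinder y n).
Proof.
elim: n => [|n IHn]; first by apply: filterS filterT.
have yn : nbhs y (@proj nat (fun=> discrete_topology X) n @^-1` [set y n]).
  apply: (@proj_continuous nat (fun=> discrete_topology X) n y).
  exact: discrete_set1.
apply: filterS (filterI IHn yn) => z [yz zn] k.
by rewrite ltnS leq_eqVlt => /predU1P[->|/yz].
Qed.

(** The product topology is a supremum of initial topologies, so the filter generated by the
    cylinders at [y] converges to [y] once it does so in each coordinate. *)
Lemma nbhs_omegaP y (U : set (omega_word X)) :
  nbhs y U <-> exists n, cylinder y n `<=` U.
Proof.
split=> [yU|[n nU]]; last by apply: filterS nU _; exact: nbhs_cylinder.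
pose F : set_system (omega_word X) := filter_from setT (cylinder y).
have FF : Filter F.
  apply: filter_from_filter => [|m n _ _]; first by exists 0.
  exists (maxn m n) => // z yz; split; apply: agree_leq yz.
    exact: leq_maxl.
  exact: leq_maxr.
have : F --> y.
  apply/cvg_sup => k A [_ [[B oB <-] By] BA]; apply: filterS BA _.
  by exists k.+1 => // z yz; rewrite /= yz.
by move=> /(_ U yU)[n _ nU]; exists n.
Qed.

Lemma closed_omegaP C :
  (forall y, (forall n, exists2 z, C z & agree n y z) -> C y) <-> closed C.
Proof.
split=> [cC y yC|cC y yC].
  by apply: cC => n; have [z [Cz yz]] := yC _ (nbhs_cylinder y n); exists z.
apply: cC => U /nbhs_omegaP[n nU].
by have [z Cz yz] := yC n; exists z; split=> //; apply: nU.
Qed.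
End Topology.

Lemma continuous_omega (X Y : finType) (f : omega_word X -> omega_word Y)
    (b : nat -> nat) :
  (forall p y z, agree (b p) y z -> f z p = f y p) -> continuous f.
Proof.
move=> fb y U /nbhs_omegaP[n nU]; apply/nbhs_omegaP.
exists (\max_(p < n) b p) => z yz; apply: nU => p pn; apply: fb.
by apply: agree_leq yz; exact: (leq_bigmax (Ordinal pn)).
Qed.

Lemma preimage_Borel (Z W : topologicalType) (f : W -> Z) n :
  continuous f ->
  (forall A, Sigma0 n A -> Sigma0 n (f @^-1` A)) /\
  (forall A, Pi0 n A -> Pi0 n (f @^-1` A)).
Proof.
move=> cf; elim: n => [|[|n] [IHS IHP]]; first by split=> ? [].
  by split=> A; [move/continuousP: cf; apply|move/continuous_closedP: cf; apply].
split=> _ [F FF ->].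
  by exists (fun i => f @^-1` F i) => [i|]; [exact/IHP/FF|rewrite preimage_bigcup].
by exists (fun i => f @^-1` F i) => [i|]; [exact/IHS/FF|rewrite preimage_bigcap].
Qed.

(** * Positions of the letters A in [alpha] *)

(** The position in [alpha] of A number [i], counting from 0. *)
Definition start i := size (concat_upto alpha_block i).

Lemma concat_uptoS (X : finType) (w : nat -> seq X) n :
  concat_upto w n.+1 = concat_upto w n ++ w n.
Proof. by rewrite /concat_upto -addn1 iotaD map_cat flatten_cat /= cats0. Qed.

Lemma start0 : start 0 = 0. Proof. by []. Qed.

Lemma startS i : start i.+1 = start i + i.+2.
Proof. by rewrite /start concat_uptoS size_cat /= size_nseq. Qed.

Lemma leq_start i j : i <= j -> start i <= start j.
Proof.
by move=> /subnK <-; elim: (j - i) => // k IHk; rewrite addSn startS; lia.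
Qed.

Lemma geq_start i : i <= start i.
Proof. by elim: i => // i IHi; rewrite startS; lia. Qed.

(** The index of the block of [alpha] that contains position [p]. *)
Fixpoint row p :=
  if p is p'.+1 then
    if p == start (row p').+1 then (row p').+1 else row p'
  else 0.

Lemma row_bounds p : start (row p) <= p < start (row p).+1.
Proof.
elim: p => [|p IHp] //=; case: eqP => [->|]; rewrite ?startS in IHp *; lia.
Qed.

Lemma row_uniq i p : start i <= p < start i.+1 -> row p = i.
Proof.
move=> ip; have rp := row_bounds p.
case: (ltngtP (row p) i) => // [/leq_start|/leq_start]; lia.
Qed.

Lemma row_start i j : j < i.+2 -> row (start i + j) = i.
Proof. by move=> ji; apply: row_uniq; rewrite startS; lia. Qed.

Lemma alpha_start i j : j < i.+2 ->
  alpha (start i + j) = if j == 0 then LA else L0.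
Proof.
move=> ji; have [/(_ i.+1) /(congr1 (fun s => nth L0 s (start i + j)))] := alphaE.
rewrite -/(start i.+1) nth_mkseq ?startS; last by lia.
by rewrite concat_uptoS nth_cat -/(start i) ltnNge leq_addr /= addKn =>
  <- _; case: j {ji} => // j; rewrite -nth_behead nth_nseq if_same.
Qed.

Lemma alpha_row p : alpha p = if p == start (row p) then LA else L0.
Proof.
have rp := row_bounds p; have jp : p = start (row p) + (p - start (row p)) by lia.
rewrite {1}jp alpha_start; last by rewrite startS in rp; lia.
by have -> : (p - start (row p) == 0) = (p == start (row p)) by lia.
Qed.

Lemma alpha_eqA p : (alpha p == LA) = (p == start (row p)).
Proof. by rewrite alpha_row; case: ifP; rewrite ?eqxx // => _; apply/eqP. Qed.

(* Row [i] of [s] consists of the [i.+1] letters at the positions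
   [start i + j.+1], [j <= i]. *)
Definition triangular (s : omega_word Gamma) : Prop :=
  forall p, (s p == LA) = (alpha p == LA).

Definition columns_vanish (s : omega_word Gamma) : Prop :=
  forall j, exists m, forall i, m <= i -> j <= i -> s (start i + j.+1) = L0.

(** * The automaton and its runs *)

(* [Check0] to [Scan] read both tapes at the same position; [Ahead] moves the
   first head one row ahead, and [Compare] and [Over] compare the two rows;
   [Shift], [Zeros] and [Free] are for the columns, [Zeros] accepting only zeros
   on the first tape and [Shift] being [Zeros] right after the lag has grown. *)
Inductive phase :=
  | Check0 | Check1 | Check2 | Scan | Ahead | Compare | Over
  | Free | Zeros | Shift | Sink.

Definition phases :=
  [:: Check0; Check1; Check2; Scan; Ahead; Compare; Over; Free; Zeros; Shift;
      Sink].

Definition phase_to_ord (q : phase) : 'I_11 :=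
  inord (match q with
    | Check0 => 0 | Check1 => 1 | Check2 => 2 | Scan => 3 | Ahead => 4
    | Compare => 5 | Over => 6 | Free => 7 | Zeros => 8 | Shift => 9
    | Sink => 10 end).

Definition ord_to_phase (i : 'I_11) : phase := nth Sink phases i.

Lemma phase_to_ordK : cancel phase_to_ord ord_to_phase.
Proof. by case; rewrite /ord_to_phase /= inordK. Qed.

HB.instance Definition _ := Finite.copy phase (can_type phase_to_ordK).

(** [o = None] stands for an empty factor on the second tape. *)
Definition step (q : phase) (x : Gamma) (o : option Gamma) (q' : phase) : bool :=
  let a := x == LA in
  if o is Some y then
    let b := y == LA in
    match q, q' with
    | Check0, Check1 | Check1, Check2 | Check2, Scan | Scan, Scan => true
    | Check0, Sink | Check2, Sink => ~~ b || (a != b)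
    | Check1, Sink => (y != L0) || (a != b)
    | Scan, Sink => (y == L1) || (a != b)
    | Check0, Ahead | Check2, Ahead | Scan, Ahead => a && b
    | Compare, Compare => ~~ a && ~~ b
    | Compare, Sink => a
    | Compare, Over => ~~ a && b
    | Over, Sink => ~~ a
    | Shift, Zeros | Zeros, Zeros => (x == L0) && ~~ b
    | Shift, Free | Zeros, Free => ~~ a && b
    | Free, Free => ~~ a && ~~ b
    | Free, Zeros => a && ~~ b
    | Sink, Sink => true
    | _, _ => false
    end
  else
    match q, q' with
    | Check0, Shift | Free, Shift => a
    | Ahead, Ahead => ~~ a
    | Ahead, Compare => a
    | _, _ => false
    end.

Definition step_label (d : phase * Gamma * option Gamma * phase) :=
  let: (q, x, o, q') := d in (q, [:: x], seq_of_opt o, q').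

Definition machine : buchi2 Gamma Gamma := {|
  state := phase;
  transitions := [fset step_label d |
    d in [pred d : phase * Gamma * option Gamma * phase |
            step d.1.1.1 d.1.1.2 d.1.2 d.2]]%fset;
  initial := Check0;
  accepting := [set Shift; Sink]%SET |}.

Lemma machine_transition q us vs q' :
  (q, us, vs, q') \in transitions machine <->
  exists x o, [/\ step q x o q', us = [:: x] & vs = seq_of_opt o].
Proof.
split=> [/imfsetP[[[[p x] o] p'] /= pxop' [-> -> -> ->]]|[x [o [st -> ->]]]].
  by exists x, o.
by apply/imfsetP; exists (q, x, o, q').
Qed.

(* Every transition reads exactly one letter of the first tape, so that the
   first head is at [t] at time [t]; [h t] is the position of the second. *)
Definition run (s u : omega_word Gamma) (q : nat -> phase) (h : nat -> nat) :=
  [/\ q 0 = Check0, h 0 = 0 &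
    forall t, exists2 b : bool, h t.+1 = b + h t &
      step (q t) (s t) (if b then Some (u (h t)) else None) (q t.+1)].

Lemma concat_uptoE (X : finType) (w : nat -> seq X) (u : omega_word X)
    (h : nat -> nat) :
  h 0 = 0 -> (forall t, w t = drop (h t) (mkseq u (h t.+1))) ->
  (forall t, h t <= h t.+1) ->
  forall t, concat_upto w t = mkseq u (h t).
Proof.
move=> h0 wE hS; elim=> [|t IHt]; first by rewrite h0.
rewrite concat_uptoS IHt wE -{2}(cat_take_drop (h t) (mkseq u (h t.+1))).
congr cat; rewrite /mkseq -map_take take_iota.
by rewrite (minn_idPl (hS t)).
Qed.

(** Unboundedness of [h] says that the second tape is read entirely; for the first tape this is
    automatic. *)
Lemma accepted_runP s u :
  accepted machine (s, u) <->
  exists q h, [/\ run s u q h, forall m, exists t, m <= h t &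
    exists2 qf, qf = Shift \/ qf = Sink &
      forall m, exists2 t, m <= t & q t = qf].
Proof.
split.
  move=> [q [us [vs [[/= q0 qS sus uvs] [qf qf_acc qf_inf]]]]].
  have stepE t : exists x o, [/\ step (q t) x o (q t.+1), us t = [:: x] &
      vs t = seq_of_opt o] by apply/machine_transition.
  have sz_us t : size (concat_upto us t) = t.
    elim: t => // t IHt; rewrite concat_uptoS size_cat IHt.
    by have [x [o [_ -> _]]] := stepE t; rewrite addn1.
  exists q, (fun t => size (concat_upto vs t)); split; last 2 first.
  - exact: uvs.2.
  - by exists qf => //; move: qf_acc; rewrite !inE => /orP[]/eqP; tauto.
  split=> // t; have [x [o [st usE vsE]]] := stepE t.
  suff [xE yE] : x = s t /\
      (forall y, o = Some y -> y = u (size (concat_upto vs t))).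
    exists (isSome o); first by rewrite concat_uptoS size_cat vsE addnC; case: o {st vsE yE}.
    by rewrite -xE; case: o st yE {vsE} => //= y st /(_ y erefl) <-.
  have := sus.1 t.+1; rewrite concat_uptoS sus.1 usE !size_cat size_mkseq.
  rewrite sz_us /= addn1 /mkseq -[in RHS]addn1 iotaD map_cat => /eqP.
  rewrite eqseq_cat// eqxx /= eqseq_cons andbT add0n => /eqP xE.
  split=> // y oE; have := uvs.1 t.+1.
  rewrite concat_uptoS vsE oE size_cat {1}uvs.1 addn1 /mkseq.
  rewrite -[in RHS]addn1 iotaD map_cat => /eqP.
  by rewrite eqseq_cat ?size_map ?size_iota// eqxx add0n => /eqP[].
move=> [q [h [[q0 h0 qS] h_inf [qf qfE qf_inf]]]].
have hS t : h t <= h t.+1 by have [b ->] := qS t; rewrite leq_addl.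
exists q, (fun t => [:: s t]), (fun t => drop (h t) (mkseq u (h t.+1))).
have usE : forall t, concat_upto (fun t => [:: s t]) t = mkseq s t.
  by elim=> // t IHt; rewrite concat_uptoS IHt /mkseq -[in RHS]addn1 iotaD map_cat.
have vsE := concat_uptoE (w := fun t => drop (h t) (mkseq u (h t.+1)))
  h0 (fun=> erefl) hS.
split; last by exists qf => //; rewrite !inE; case: qfE => ->; rewrite eqxx ?orbT.
split=> //= [t||].
- apply/machine_transition; have [b hb st] := qS t.
  exists (s t), (if b then Some (u (h t)) else None); split=> //.
  rewrite hb; case: b {hb st} => /=.
    rewrite add1n /mkseq -addn1 iotaD map_cat drop_size_cat //.
    by rewrite size_map size_iota.
  by rewrite drop_oversize // size_mkseq.
- by split=> [t|m]; [rewrite usE size_mkseq|exists m; rewrite usE size_mkseq].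
- by split=> [t|m]; [|have [t mt] := h_inf m; exists t]; rewrite vsE size_mkseq.
Qed.

(** * Acceptance on aligned tapes forces the columns to vanish *)

Lemma alpha_in_row i p : start i < p <= start i.+1 ->
  (alpha p == LA) = (p == start i.+1).
Proof.
move=> ip; rewrite alpha_eqA; case: (eqVneq p (start i.+1)) => [->|pS].
  by rewrite (_ : row _ = i.+1) ?eqxx //; apply: row_uniq; rewrite !startS; lia.
by rewrite (@row_uniq i) //; lia.
Qed.

Lemma alpha_startA i : alpha (start i) == LA.
Proof. by rewrite -[start i]addn0 alpha_start ?eqxx. Qed.

Lemma alpha_below_start i p : p < start i -> (forall j, j < i -> start j < p) ->
  (alpha p == LA) = false.
Proof.
move=> pi ltp; rewrite alpha_eqA; apply/eqP => pE.
have := ltp (row p); rewrite -pE ltnn => H; suff : false by [].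
apply: H; rewrite ltnNge; apply/negP => /leq_start; lia.
Qed.

Lemma alpha_neq1 p : alpha p <> L1.
Proof. by rewrite alpha_row; case: ifP. Qed.

(** Where the heads can be on aligned tapes. In [Compare] they are at the same offset of consecutive
    rows; in [Zeros] and [Shift] the second head has not yet passed the A that opens the row of the
    first. *)
Definition head_invariant (q : phase) (t h : nat) : Prop :=
  match q with
  | Check0 => t = 0 /\ h = 0
  | Check1 => t = 1 /\ h = 1
  | Check2 => t = 2 /\ h = 2
  | Scan => h = t
  | Ahead => exists2 i, h = (start i).+1 & start i < t <= start i.+1
  | Compare => exists i k,
      [/\ h = start i + k.+1, t = start i.+1 + k.+1 & k <= i.+1]
  | Over => exists i, t = start i
  | Free => exists2 i, start i < t <= start i.+1 & start i < h <= start i.+1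
  | Zeros | Shift => exists i,
      [/\ start i < t <= start i.+1, h <= start i
        & forall j, j < i -> start j < h]
  | Sink => False
  end.

(** Whether a head reads an A is decided by its position, and [alpha] contains no 1; this rules out
    every move into [Sink]. *)
Lemma head_invariant_step s q q' t h (b : bool) : triangular s ->
  head_invariant q t h ->
  step q (s t) (if b then Some (alpha h) else None) q' ->
  head_invariant q' t.+1 (b + h).
Proof.
move=> tri; have A0 : alpha 0 == LA by exact: (alpha_startA 0).
have A2 : alpha 2 == LA by exact: (alpha_startA 1).
have A1 : alpha 1 = L0 by rewrite alpha_row.
(* [Zeros] and [Shift] share their outgoing transitions and their invariant. *)
have zeros (c : bool) r : head_invariant Zeros t h ->
    step Zeros (s t) (if c then Some (alpha h) else None) r ->
    head_invariant r t.+1 (c + h).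
  move=> [i [it ih jh]]; case: c; case: r => //=.
  + rewrite tri (alpha_in_row it) => /andP[/eqP tS].
    have [hi|hi] := ltnP h (start i); first by rewrite (alpha_below_start hi).
    move=> _; exists i; rewrite startS in tS it *; lia.
  + move=> /andP[/eqP sE hA]; have tA := alpha_in_row it.
    rewrite -tri sE in tA; have {}tA : t <> start i.+1.
      by move=> tS; move: tA; rewrite -tS eqxx => /eqP.
    have hi : h <> start i by move=> hS; move: hA; rewrite hS alpha_startA.
    exists i; split=> [||j /jh]; lia.
case: q => /=.
- move=> [-> ->]; case: b; case: q' => //=; rewrite tri A0 // => _.
  + by exists 0 => //; rewrite startS.
  + by exists 0; split=> //; rewrite startS.
- by move=> [-> ->]; case: b; case: q' => //=; rewrite tri A1 !eqxx.
- move=> [-> ->]; case: b; case: q' => //=; rewrite tri A2 // => _.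
  by exists 1 => //; rewrite !startS.
- move=> ->; case: b; case: q' => //=; rewrite tri.
    rewrite andbb alpha_eqA => /eqP tE; exists (row t); first by rewrite add1n {1}tE.
    by rewrite startS; lia.
  by rewrite eqxx orbF => /eqP/alpha_neq1.
- move=> [i -> it]; case: b; case: q' => //=; rewrite tri (alpha_in_row it).
    by move=> /eqP ti; exists i => //; lia.
  move=> /eqP ti; exists i, 0; split => //; lia.
- move=> [i [k [-> -> ki]]]; case: b; case: q' => //=; rewrite tri.
  + rewrite (@alpha_in_row i.+1) ?(@alpha_in_row i); rewrite ?startS; try lia.
    move=> /andP[/eqP tS /eqP hS]; exists i, k.+1; rewrite ?startS; split; lia.
  + rewrite (@alpha_in_row i.+1) ?(@alpha_in_row i); rewrite ?startS; try lia.
    move=> /andP[/eqP tS /eqP hS]; exists i.+2; rewrite ?startS; lia.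
  + by rewrite (@alpha_in_row i.+1); rewrite !startS; lia.
- by move=> [i ->]; case: b; case: q' => //=; rewrite tri alpha_startA.
- move=> [i it ih]; case: b; case: q' => //=; rewrite tri (alpha_in_row it).
  + by rewrite (alpha_in_row ih) => /andP[/eqP tS /eqP hS]; exists i; lia.
  + rewrite (alpha_in_row ih) => /andP[/eqP tS /eqP hS]; exists i.+1.
    rewrite (startS i.+1); split; try lia.
    by move=> j; rewrite ltnS => /leq_start; lia.
  + move=> /eqP tS; exists i.+1; rewrite (startS i.+1); split; try lia.
    by move=> j; rewrite ltnS => /leq_start; lia.
- exact: zeros.
- exact: zeros.
- by [].
Qed.

Definition in_main q :=
  match q with Free | Zeros | Shift => true | _ => false end.

Lemma step_main q x o q' : in_main q -> step q x o q' -> in_main q'.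
Proof. by case: q; case: o => [y|]; case: q'. Qed.

(* Once in these phases, only the transitions into [Shift] let the second head
   stay behind, so an infinity of them makes the lag [t - h t] unbounded. *)
Lemma run_lag s u q h : run s u q h ->
  (forall m, exists2 t, m <= t & q t = Shift) ->
  forall l, exists t0, forall t, t0 <= t -> in_main (q t) /\ h t + l <= t.
Proof.
move=> [q0 h0 qS] q_inf.
have main_leq t t' : t <= t' -> in_main (q t) -> in_main (q t').
  move=> /subnK <-; elim: (t' - t) => // k IHk /IHk; rewrite addSn.
  by have [b _ st] := qS (k + t) => /step_main; apply; exact: st.
have lag_leq l t t' : t <= t' -> h t + l <= t -> h t' + l <= t'.
  move=> /subnK <-; elim: (t' - t) => // k IHk /IHk; rewrite addSn.
  by have [[] -> _] := qS (k + t); lia.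
elim=> [|l [t0 IHl]].
  have [t _ qt] := q_inf 0; exists t => t' tt'; split.
    by apply: main_leq tt' _; rewrite qt.
  by apply: lag_leq tt' _; rewrite addn0; elim: t {qt} => [|t IHt];
    [rewrite h0|have [[] -> _] := qS t; lia].
(* Asking for a time from [t0.+1] on gives the visit to [Shift] a predecessor [t >= t0], at which
   the lag is already [l]. *)
have [[|t] tt qt] := q_inf t0.+1; first by [].
exists t.+1 => t' tt'; have [_ ht] := IHl t tt.
split; first by apply: main_leq tt' _; rewrite qt.
apply: lag_leq tt' _; have [b hb] := qS t; rewrite qt.
case: b hb => [|->]; last by lia.
by case: (q t).
Qed.

Lemma accepted_alpha_columns s : triangular s -> accepted machine (s, alpha) ->
  columns_vanish s.
Proof.
move=> tri /accepted_runP[q [h [rn _ [qf qfE qf_inf]]]].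
have inv t : head_invariant (q t) t (h t).
  have [q0 h0 qS] := rn; elim: t => [|t IHt]; first by rewrite q0 h0.
  by have [b -> st] := qS t; exact: head_invariant_step IHt st.
case: qfE qf_inf => ->{qf} q_inf; last first.
  by have [t _ qt] := q_inf 0; have := inv t; rewrite qt.
(* A lag of [j.+2] at position [start i + j.+1] leaves the second head strictly before [start i]. *)
move=> j; have [t0 lagP] := run_lag rn q_inf j.+2; exists t0 => i t0i ji.
set t := start i + j.+1.
have it : start i < t <= start i.+1 by rewrite startS /t; lia.
have [] := lagP t; first by have := geq_start i; lia.
have [_ _ /(_ t)[b _]] := rn; have /= := inv t.
have in_row i' : start i' < t <= start i'.+1 -> i' = i.
  by case: (ltngtP i' i) => // /leq_start; lia.
(* The second head is strictly between two A's, so the only transition left reads a zero on the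
   first tape. *)
have zeros : (exists i', [/\ start i' < t <= start i'.+1, h t <= start i'
    & forall j, j < i' -> start j < h t]) -> h t + j.+2 <= t ->
  forall q', step Zeros (s t) (if b then Some (alpha (h t)) else None) q' ->
  s t = L0.
  move=> [i' [/in_row-> _ jh]] ht.
  have hi : h t < start i by rewrite /t in ht *; lia.
  by case: b => //= -[]//=; rewrite (alpha_below_start hi jh) ?andbF // => /andP[/eqP].
case: (q t) => //=.
- move=> [i' /in_row-> ih] _ _ ht; have tE : t = start i + j.+1 by []; lia.
- by move=> iv st _ /(zeros iv); apply; exact: st.
- by move=> iv st _ /(zeros iv); apply; exact: st.
Qed.

(** * The accepting run when the columns vanish *)

Section MainRun.
Variables (s : omega_word Gamma).
Hypotheses (tri : triangular s) (cv : columns_vanish s).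

Definition blank_from i l : Prop :=
  forall k, i <= k -> forall j, j < l -> j <= k -> s (start k + j.+1) = L0.

(** A greedy schedule, decided classically: the lag grows at a row as soon as the columns below its
    current value are zero from that row on. It starts at 1 because the move from [Check0] to
    [Shift] leaves the second head in place. *)
Fixpoint lag i :=
  if i is i'.+1 then
    if `[< blank_from i (lag i') >] then (lag i').+1 else lag i'
  else 1.

Lemma lagS i :
  lag i.+1 = (lag i).+1 /\ blank_from i.+1 (lag i) \/ lag i.+1 = lag i.
Proof. by rewrite /=; case: asboolP => ?; [left|right]. Qed.

Lemma lag_gt0 i : 0 < lag i.
Proof. by elim: i => // i IHi; have [[->]|->] := lagS i. Qed.

(** This bound keeps the second head at most one row behind the first. *)
Lemma lag_leqS i : lag i <= i.+1.
Proof. by elim: i => // i IHi; have [[->]|->] := lagS i; lia. Qed.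

(** These are the cells of row [i] read while the second head is before [start i]. *)
Lemma lag_blank i : blank_from i (lag i).-1.
Proof.
elim: i => [|i IHi]; first by move=> k _ j; rewrite ltn0.
have [[-> //]|->] := lagS i.
by move=> k ik; apply: IHi; apply: ltnW.
Qed.

Lemma exists_blank_from l : exists m, blank_from m l.
Proof.
elim: l => [|l [m IHl]]; first by exists 0 => k _ j; rewrite ltn0.
have [m' lP] := cv l; exists (maxn m m') => k; rewrite geq_max => /andP[mk m'k] j.
by rewrite ltnS leq_eqVlt => /predU1P[-> /(lP _ m'k)|jl jk]//; exact: IHl.
Qed.

(** If the lag were constant from some row on, the finitely many columns below it would all be zero
    eventually, and the schedule would increase it. *)
Lemma lag_grows m : exists2 i, m <= i & lag i.+1 = (lag i).+1.
Proof.
apply: contrapT => no_growth.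
have lagE i : m <= i -> lag i = lag m.
  move=> /subnK <-; elim: (i - m) => // k <-; rewrite addSn.
  have [[E _]|//] := lagS (k + m); case: no_growth; exists (k + m) => //.
  by rewrite leq_addl.
have [m' mP] := exists_blank_from (lag m).
have mm : m <= maxn m m' by rewrite leq_maxl.
case: no_growth; exists (maxn m m') => //=; case: asboolP => // -[].
rewrite lagE // => k mk; apply: mP.
by apply: leq_trans (ltnW mk); rewrite leq_maxr.
Qed.

(** The last letter read on the first tape is at [t.-1], and its row fixes the lag; at time 0 the
    truncated subtraction gives 0. *)
Definition main_head t := t - lag (row t.-1).

Definition main_phase t :=
  if t is p.+1 then
    let i := row p in
    if (p == start i) && ((i == 0) || (lag i != lag i.-1)) then Shift
    else if start i < main_head t then Free else Zeros
  else Check0.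

Lemma main_phase_in_row i t : (start i).+1 < t <= start i.+1 ->
  main_phase t = if start i < main_head t then Free else Zeros.
Proof.
case: t => // p ip; rewrite /main_phase (@row_uniq i); last by lia.
by case: eqP => // pE; lia.
Qed.

Lemma main_phase_start i : main_phase (start i).+1 =
  if (i == 0) || (lag i != lag i.-1) then Shift else Zeros.
Proof.
rewrite /main_phase (@row_uniq i) ?startS; last by lia.
rewrite eqxx /=; case: ifP => // _; rewrite /main_head /= (@row_uniq i) ?startS; last by lia.
by have l0 := lag_gt0 i; case: ltnP => //; lia.
Qed.

Lemma main_run : run s alpha main_phase main_head.
Proof.
split=> // t; case: t => [|p].
  exists false; last by rewrite (main_phase_start 0) /= tri; exact: (alpha_startA 0).
  by rewrite /main_head /= .
have ip := row_bounds p; set i := row p in ip.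
have lag0 := lag_gt0 i; have lagi := lag_leqS i.
have ii : i <= start i := geq_start i.
have hE : main_head p.+1 = p.+1 - lag i by [].
(* The first head is on the A opening row [i.+1]; the second head waits exactly when the lag
   grows. *)
have [pS|pS] := eqVneq p.+1 (start i.+1).
  have lagS0 := lag_gt0 i.+1.
  have rS : row p.+1 = i.+1 by apply: row_uniq; rewrite pS (startS i.+1); lia.
  have h'E : main_head p.+2 = p.+2 - lag i.+1 by rewrite /main_head rS.
  have q'E := main_phase_start i.+1; rewrite -pS in q'E.
  rewrite {}q'E (@main_phase_in_row i); last by rewrite -pS; rewrite startS in pS; lia.
  rewrite ifT; last by rewrite hE; rewrite startS in pS; lia.
  have sA : s p.+1 == LA by rewrite tri pS alpha_startA.
  have [[lE _]|lE] := lagS i.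
    exists false; first by rewrite h'E hE lE; lia.
    by rewrite lE /= gtn_eqF //= sA.
  exists true; first by rewrite h'E hE lE startS in pS *; lia.
  rewrite lE eqxx /= sA (@alpha_in_row i) hE; rewrite startS in pS *; lia.
have tlt : start i < p.+1 < start i.+1 by lia.
have rS : row p.+1 = i by apply: row_uniq; lia.
have h'E : main_head p.+2 = p.+2 - lag i by rewrite /main_head rS.
have sNA : (s p.+1 == LA) = false by rewrite tri (@alpha_in_row i); lia.
exists true; first by rewrite h'E hE; lia.
rewrite (@main_phase_in_row i p.+2) ?h'E; last by lia.
have [ih|hi] := ltnP (start i) (main_head p.+1).
  have -> : main_phase p.+1 = Free.
    rewrite (@main_phase_in_row i) ?ih //; lia.
  by rewrite ifT /= ?sNA ?(@alpha_in_row i) ?hE; lia.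
have {}q'E : main_phase p.+1 = Shift \/ main_phase p.+1 = Zeros.
  have [pE|pS'] := eqVneq p (start i).
    by rewrite pE main_phase_start; case: ifP; [left|right].
  by right; rewrite (@main_phase_in_row i) ?ifN //; lia.
(* Reading the A that opens row [i] on the second tape leads to [Free]; before that, [lag_blank]
   supplies the zero on the first tape. *)
have [hE'|hN] := eqVneq (main_head p.+1) (start i).
  by rewrite ifT; [case: q'E => -> /=; rewrite sNA hE' alpha_startA|lia].
rewrite ifN; last by lia.
have s0 : s p.+1 == L0.
  have -> : p.+1 = start i + (p - start i).+1 by lia.
  apply/eqP/(@lag_blank i) => //; rewrite ?startS in tlt; lia.
have hA : (alpha (main_head p.+1) == LA) = false.
  apply: (@alpha_below_start i) => [|j ji]; first by lia.
  have iE : start i = start i.-1 + i.+1 by rewrite -{1}(ltn_predK ji) startS; lia.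
  have := @leq_start j i.-1; rewrite hE; lia.
by case: q'E => -> /=; rewrite s0 hA.
Qed.

Lemma columns_accepted : accepted machine (s, alpha).
Proof.
apply/accepted_runP; exists main_phase, main_head; split.
- exact: main_run.
- move=> m; exists (start m.+1).+1; rewrite /main_head succnK (@row_uniq m.+1).
    by have := lag_leqS m.+1; have := geq_start m; rewrite startS; lia.
  by rewrite !startS; lia.
- exists Shift; first by left.
  move=> m; have [i mi iE] := lag_grows m; exists (start i.+1).+1.
    by have := geq_start i.+1; lia.
  by rewrite main_phase_start iE /= gtn_eqF.
Qed.
End MainRun.

(** * Acceptance of every deviation *)

(** In [Sink] both heads advance by one letter at each step without any test, so a finite run
    reaching it extends to a successful one. *)
Lemma accepted_sink s u q h n :
  q 0 = Check0 -> h 0 = 0 ->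
  (forall t, t < n -> exists2 b : bool, h t.+1 = b + h t &
      step (q t) (s t) (if b then Some (u (h t)) else None) (q t.+1)) ->
  step (q n) (s n) (Some (u (h n))) Sink ->
  accepted machine (s, u).
Proof.
move=> q0 h0 qS qn; apply/accepted_runP.
exists (fun t => if t <= n then q t else Sink).
exists (fun t => if t <= n then h t else h n + (t - n)); split=> [|m|].
- split=> //= t; have [tn|tn|->] := ltngtP t n; first exact: qS.
    by exists true => //; lia.
  by exists true => //; lia.
- by exists (n.+1 + m); rewrite ifN; lia.
- by exists Sink; [right|move=> m; exists (n.+1 + m); [|rewrite ifN //]; lia].
Qed.

Definition sync_phase t :=
  match t with 0 => Check0 | 1 => Check1 | 2 => Check2 | _ => Scan end.

Lemma step_sync t x y : step (sync_phase t) x (Some y) (sync_phase t.+1).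
Proof. by case: t => [|[|[|t]]]. Qed.

Lemma accepted_sync s u n :
  step (sync_phase n) (s n) (Some (u n)) Sink -> accepted machine (s, u).
Proof.
apply: (@accepted_sink s u sync_phase id) => // t _.
by exists true => //; exact: step_sync.
Qed.

Section Escape.
Variables s u : omega_word Gamma.

(** The common A pattern of the tapes first departs from [alpha] at the end of row [i.+1], which is
    too short or too long. The run leaves the synchronous phases at the A opening row [i]. *)
Lemma compare_accepted i p :
  (forall k, k < p -> (u k == LA) = (alpha k == LA)) ->
  (forall k, (s k == LA) = (u k == LA)) ->
  start i.+1 < p <= start i.+2 ->
  (u p == LA) != (alpha p == LA) ->
  accepted machine (s, u).
Proof.
move=> u_lt su ip up.
pose q t := if t <= start i then sync_phase t
  else if t <= start i.+1 then Ahead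
  else if t < start i.+2 then Compare else Over.
(* During the comparison the heads are [i.+2] apart, the length of block [i]. *)
pose h t := if t <= start i then t
  else if t <= start i.+1 then (start i).+1 else t - i.+2.
have iS := startS i; have iSS := startS i.+1.
have q1 t : t <= start i -> q t = sync_phase t by rewrite /q => ->.
have q2 t : start i < t <= start i.+1 -> q t = Ahead.
  by move=> /andP[it ti]; rewrite /q ifN ?ti // -ltnNge.
have q3 t : start i.+1 < t < start i.+2 -> q t = Compare.
  by move=> /andP[it ti]; rewrite /q ti !ifN //; lia.
have q4 : q (start i.+2) = Over by rewrite /q !ifN //; lia.
have h1 t : t <= start i -> h t = t by rewrite /h => ->.
have h2 t : start i < t <= start i.+1 -> h t = (start i).+1.
  by move=> /andP[it ti]; rewrite /h ifN ?ti // -ltnNge.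
have h3 t : start i.+1 < t -> h t = t - i.+2.
  by move=> it; rewrite /h !ifN //; lia.
have uE j k : start j < k <= start j.+1 -> k < p ->
    (u k == LA) = (k == start j.+1).
  by move=> jk kp; rewrite u_lt // (alpha_in_row jk).
apply: (@accepted_sink s u q h p) => // [t tp|].
  have [ti|ti|ti] := ltngtP t (start i).
  - exists true; first by rewrite !h1 //; lia.
    by rewrite !q1 ?h1 //; [exact: step_sync|lia|lia].
  - have [ti'|ti'|ti'] := ltngtP t (start i.+1).
    + exists false; first by rewrite !h2 //; lia.
      rewrite !q2 /= ?su ?(@uE i) //; lia.
    + have tlt : start i.+1 < t < start i.+2 by lia.
      exists true; first by rewrite !h3 //; lia.
      have st : (s t == LA) = false by rewrite su (@uE i.+1); lia.
      have ut : (u (t - i.+2) == LA) = (t.+1 == start i.+2).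
        by rewrite (@uE i); lia.
      rewrite h3 // q3 //; have [tS|tS] := eqVneq t.+1 (start i.+2).
        by rewrite tS q4 /= st ut tS eqxx.
      by rewrite q3 /= ?st ?ut //; lia.
    + exists false; first by rewrite (h2 t) ?(h3 t.+1); lia.
      rewrite (q2 t) ?(q3 t.+1) /= ?su ?(@uE i) //; lia.
  - have tA : u t == LA by rewrite u_lt // ti alpha_startA.
    exists true; first by rewrite (h1 t) ?(h2 t.+1) //; lia.
    rewrite (h1 t) ?(q1 t) ?(q2 t.+1) ?ti //; last by lia.
    have sA : s t == LA by rewrite su.
    (* [Check1], which has no move to [Ahead], is excluded since [start i] is never 1. *)
    suff [-> | [-> | ->]] : sync_phase (start i) = Check0 \/ sync_phase (start i) = Check2 \/
        sync_phase (start i) = Scan by rewrite -ti /= sA tA.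
    case: (i) => [|[|k]]; [by left|by right; left|right; right].
    by rewrite !startS !addnS.
(* A missing A is caught in [Over], a premature one in [Compare]. *)
have [pS|pS] := eqVneq p (start i.+2).
  by move: up; rewrite pS q4 alpha_startA /= su; case: (u _ == LA).
move: up; rewrite (@alpha_in_row i.+1) // (negbTE pS) q3; last by lia.
by rewrite /= su; case: (u _ == LA).
Qed.

End Escape.

Lemma sync_phase_Scan t : 2 < t -> sync_phase t = Scan.
Proof. by case: t => [|[|[|t]]]. Qed.

Lemma deviation_accepted s u : ~ (triangular s /\ u = alpha) ->
  accepted machine (s, u).
Proof.
move=> dev; apply: contrapT => nacc.
have no_escape n : ~~ step (sync_phase n) (s n) (Some (u n)) Sink.
  by apply/negP => /accepted_sync.
have su k : (s k == LA) = (u k == LA).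
  have := no_escape k; case: k => [|[|[|k]]] /=; rewrite negb_or => /andP[_];
  by rewrite negbK => /eqP.
have u0 : u 0 == LA by have := no_escape 0; rewrite /= negb_or negbK => /andP[].
have u1 : u 1 == L0 by have := no_escape 1; rewrite /= negb_or negbK => /andP[].
have u2 : u 2 == LA by have := no_escape 2; rewrite /= negb_or negbK => /andP[].
have u_neq1 k : u k <> L1.
  have [|] := ltnP 2 k.
    move=> k2; have := no_escape k; rewrite sync_phase_Scan //= negb_or.
    by case: eqP.
  by case: k => [|[|[|k]]] //; rewrite ?(eqP u0) ?(eqP u1) ?(eqP u2).
(* Without the letter 1, [u] is determined by the positions of its A's. *)
have [ua|nua] := pselect (forall k, (u k == LA) = (alpha k == LA)).
  apply: dev; split=> [k|]; first by rewrite su ua.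
  apply/funext => k; move: (ua k) (u_neq1 k) (@alpha_neq1 k).
have L0A : (L0 == LA) = false by apply/eqP.
  by case: (u k); case: (alpha k) => //; rewrite eqxx L0A.
have [p up p_min] : exists2 p, (u p == LA) != (alpha p == LA) &
    forall k, k < p -> (u k == LA) = (alpha k == LA).
  have [p0 up0] : exists p, (u p == LA) != (alpha p == LA).
    by apply: contra_notP nua => all k; apply: contrapT => /eqP uk; apply: all; exists k.
  have [p up pmin] := ex_minnP (ex_intro (fun p => (u p == LA) != (alpha p == LA)) p0 up0).
  exists p => // k; apply: contraTeq => /pmin.
  by rewrite -leqNgt.
have [p2|p2] := ltnP 2 p; last first.
  case: p up p2 {p_min} => [|[|[|p]]] //= up _; move: up.
  - by rewrite u0 (alpha_startA 0 : alpha 0 == LA).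
  - by rewrite (eqP u1) (alpha_row 1) eqxx.
  - by rewrite u2 (alpha_startA 1 : alpha 2 == LA).
have [i ip] : exists i, start i.+1 < p <= start i.+2.
  have := row_bounds p.-1; case rp : (row p.-1) => [|i]; last by exists i; lia.
  by rewrite !startS start0; lia.
exact: nacc (compare_accepted p_min su ip up).
Qed.

Lemma accepted_machineE s u : accepted machine (s, u) <->
  ~ (triangular s /\ u = alpha) \/ columns_vanish s.
Proof.
split=> [acc|[|cv]]; last 2 first.
- exact: deviation_accepted.
- have [[tri ->]|] := pselect (triangular s /\ u = alpha); last exact: deviation_accepted.
  exact: columns_accepted.
have [[tri uE]|] := pselect (triangular s /\ u = alpha); last by left.
by right; apply: accepted_alpha_columns => //; rewrite -uE.
Qed.

(** * The accepted relation is in Pi^0_3 *)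

Lemma closed_letter (X : finType) n (B : set X) :
  closed [set y : omega_word X | B (y n)].
Proof.
by apply/closed_omegaP => y yB; have [z /= Bz yz] := yB n.+1; rewrite -yz.
Qed.

(** The index [m] of the union serves both as a position where a deviation shows and as a row from
    which column [j] is blank. *)
Lemma Pi0_3_accepted : Pi0 3 (accepted machine).
Proof.
pose blank j m : set (omega_word Gamma) :=
  [set s | forall i, m <= i -> j <= i -> s (start i + j.+1) = L0].
pose cell j m : set (omega_word Gamma * omega_word Gamma) :=
  fst @^-1` ([set s | (s m == LA) != (alpha m == LA)] `|` blank j m) `|`
  snd @^-1` [set u | u m != alpha m].
have closed_cell j m : closed (cell j m).
  apply: closedU.
    apply: ((continuous_closedP fst).1 (fun x => cvg_fst)).
    apply: closedU; first exact: (@closed_letter Gamma m [set x | (x == LA) != (alpha m == LA)]).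
    apply/closed_omegaP => y yC i mi ji.
    have [z zC yz] := yC (start i + j.+1).+1.
    by rewrite -yz //; exact: zC.
  apply: ((continuous_closedP snd).1 (fun x => cvg_snd)).
  exact: (@closed_letter Gamma m [set x | x != alpha m]).
exists (fun j => \bigcup_m cell j m) => [j|]; first by exists (cell j) => // m; exact: closed_cell.
apply/seteqP; split=> [[s u] /accepted_machineE su j _|[s u] cellP].
  case: su => [dev|/(_ j)[m mP]]; last by exists m => //; left; right.
  have [s_tri|] := pselect (triangular s); last first.
    by move=> /existsNP[m /eqP sm]; exists m => //; left; left.
  have /existsNP[m /eqP um] : ~ forall k, u k = alpha k.
    by move=> ua; apply: dev; split=> //; exact/funext.
  by exists m => //; right.
apply/accepted_machineE.
have [[tri uE]|] := pselect (triangular s /\ u = alpha); last by left.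
right=> j; have [m _ [[/=|sm]|/=]] := cellP j I.
- by rewrite tri => /eqP[].
- by exists m.
- by rewrite uE => /eqP[].
Qed.

(** * Reducing Pi^0_3 sets to vanishing columns *)

Section Encoding.
Context {Y : finType}.
Variable G : nat -> nat -> set (omega_word Y).
Hypothesis closedG : forall j m, closed (G j m).
Implicit Types y z : omega_word Y.

Definition consistent j i y m : bool := `[< exists2 z, G j m z & agree i y z >].

(** The least [m < i] consistent with the prefix of length [i]; [find] returns [i] if there is
    none. *)
Definition stage y j i := find (consistent j i y) (iota 0 i).

Lemma consistent_leq j i i' y m : i <= i' ->
  consistent j i' y m -> consistent j i y m.
Proof.
by move=> ii' /asboolP[z Gz yz]; apply/asboolP; exists z => //; exact: agree_leq yz.
Qed.

Lemma stage_leq y j i : stage y j i <= i.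
Proof. by rewrite -[leqRHS](size_iota 0); exact: find_size. Qed.

Lemma stage_consistent y j i : stage y j i < i ->
  consistent j i y (stage y j i).
Proof.
move=> si; have := @nth_find _ 0 (consistent j i y) (iota 0 i).
by rewrite has_find size_iota nth_iota // add0n; apply.
Qed.

Lemma stage_min y j i m : consistent j i y m -> stage y j i <= m.
Proof.
move=> cm; rewrite leqNgt; apply/negP => ms.
have mi := leq_trans ms (stage_leq y j i).
by have := before_find 0 ms; rewrite nth_iota // add0n cm.
Qed.

Lemma leq_stage y j i i' : i <= i' -> stage y j i <= stage y j i'.
Proof.
move=> ii'; have [si|si] := ltnP (stage y j i') i'.
  by apply: stage_min; apply: consistent_leq ii' _; exact: stage_consistent.
by apply: leq_trans si; apply: leq_trans ii'; exact: stage_leq.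
Qed.

(** A stable value is consistent with all prefixes, so closedness puts [y] in that set. Conversely,
    membership in [G j m] bounds the nondecreasing stage by [m]. *)
Lemma stage_stable y j :
  (exists i0, forall i, i0 <= i -> stage y j i.+1 = stage y j i) <->
  (\bigcup_m G j m) y.
Proof.
split=> [[i0 stS]|[m _ Gm]].
  have stE i : i0 <= i -> stage y j i = stage y j i0.
    by move=> /subnK <-; elim: (i - i0) => // k <-; rewrite addSn stS // leq_addl.
  exists (stage y j i0) => //; apply: ((closed_omegaP _).2 (@closedG j _)) => n.
  (* This length exceeds the stable value, so the stage is not the default of [find]. *)
  have [z Gz yz] : exists2 z, G j (stage y j i0) z & agree (i0 + n).+1 y z.
    apply/asboolP; rewrite -(stE (i0 + n).+1); last by lia.
    apply: stage_consistent; rewrite stE; last by lia.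
    by have := stage_leq y j i0; lia.
  by exists z => //; apply: agree_leq yz; lia.
have st_m i : stage y j i <= m.
  by apply: stage_min; apply/asboolP; exists y.
pose attained v := `[< exists i, stage y j i = v >].
have [||v /asboolP[i0 iv] v_max] := @ex_maxnP attained m.
- by exists (stage y j 0); apply/asboolP; exists 0.
- by move=> _ /asboolP[i <-].
have stE i : i0 <= i -> stage y j i = v.
  move=> ii; apply/eqP; rewrite eqn_leq -{2}iv leq_stage // andbT.
  by apply: v_max; apply/asboolP; exists i.
by exists i0 => i ii; rewrite !stE //; exact: leqW.
Qed.

Definition encode y : omega_word Gamma := fun p =>
  let i := row p in
  if p == start i then LA
  else if stage y (p - start i).-1 i.+1 != stage y (p - start i).-1 i then L1
  else L0.

Lemma triangular_encode y : triangular (encode y).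
Proof.
move=> p; rewrite alpha_eqA /encode; case: (p == _); first by rewrite eqxx.
by case: ifP => _; apply/eqP.
Qed.

Lemma encode_cell y i j : j <= i ->
  (encode y (start i + j.+1) = L0) <-> (stage y j i.+1 = stage y j i).
Proof.
move=> ji; rewrite /encode row_start // -[X in _ == X]addn0 eqn_add2l /= addKn /=.
by case: eqP.
Qed.

Lemma columns_vanish_encode y :
  columns_vanish (encode y) <-> (\bigcap_j \bigcup_m G j m) y.
Proof.
split=> [cv j _|yG j].
  have [m mP] := cv j; apply/stage_stable; exists (maxn m j) => i.
  by rewrite geq_max => /andP[mi ji]; apply/(encode_cell _ ji)/mP.
have /stage_stable[i0 iP] := yG j I.
by exists i0 => i ii ji; apply/(encode_cell _ ji)/iP.
Qed.

Lemma eq_stage y z j i : agree i y z -> stage z j i = stage y j i.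
Proof.
move=> yz; apply: eq_find => m; apply: asbool_equiv_eq.
by split=> -[x Gx xy]; exists x => // k ki; rewrite xy // yz.
Qed.

Lemma continuous_encode : continuous encode.
Proof.
apply: (@continuous_omega _ _ _ (fun p => (row p).+1)) => p y z yz.
by rewrite /encode (eq_stage _ yz) (eq_stage _ (agree_leq (leqnSn _) yz)).
Qed.

End Encoding.

Lemma Pi0_3_reduction (Y : finType) (E : set (omega_word Y)) : Pi0 3 E ->
  exists2 f : omega_word Y -> omega_word Gamma, continuous f &
    forall y, E y <-> accepted machine (f y, alpha).
Proof.
move=> [F FS ->]; have /choice[G GP] : forall j, exists Gj : nat -> set (omega_word Y),
    (forall m, closed (Gj m)) /\ F j = \bigcup_m Gj m.
  by move=> j; have [Gj cG FE] := FS j; exists Gj; split=> // m; exact: cG.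
exists (encode G); first exact: continuous_encode.
move=> y; rewrite accepted_machineE.
have -> : \bigcap_j F j = \bigcap_j \bigcup_m G j m.
  by apply: eq_bigcapr => j _; exact: (GP j).2.
rewrite -columns_vanish_encode; last by move=> j m; exact: (GP j).1.
(* The encoding is aligned with [alpha], which voids the deviation alternative. *)
by split=> [|[[]|]//]; [right|split=> //; exact: triangular_encode].
Qed.

(** * Completeness of the relation and of its section at [alpha] *)

Lemma Pi0_complete_reduction (Z : topologicalType) (S : set Z) n : Pi0 n S ->
  (forall (Y : finType) (E : set (omega_word Y)), Pi0 n E ->
    exists2 f : omega_word Y -> Z, continuous f & E = f @^-1` S) ->
  Pi0_complete n S.
Proof.
move=> nS red Y E; split=> [/red //|[f cf ->]].
exact: (preimage_Borel n cf).2.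
Qed.

Lemma continuous_pairl (T U : topologicalType) (a : U) :
  continuous (fun x : T => (x, a)).
Proof. by move=> x; apply: cvg_pair; [exact: cvg_id|exact: cvg_cst]. Qed.

Theorem theorem4p1 :
  exists R : set (omega_word Gamma * omega_word Gamma),
    [/\ infinitary_rational R,
        Pi0_complete 3 [set s : omega_word Gamma | R (s, alpha)],
        forall u : omega_word Gamma, u <> alpha ->
          [set s : omega_word Gamma | R (s, u)] = [set: omega_word Gamma]
      & Pi0_complete 3 R].
Proof.
have pair_cont := @continuous_pairl (omega_word Gamma) (omega_word Gamma) alpha.
exists (accepted machine); split.
- by exists machine.
- apply: Pi0_complete_reduction => [|Y E /Pi0_3_reduction[f cf fE]].
    (* The section is the preimage of the relation under [s] to [(s, alpha)]. *)
    exact: ((preimage_Borel 3 pair_cont).2 _ Pi0_3_accepted).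
  by exists f => //; apply/seteqP; split=> y /fE.
- move=> u uN; apply/seteqP; split=> // s _.
  by apply/accepted_machineE; left=> -[].
- apply: Pi0_complete_reduction => [|Y E /Pi0_3_reduction[f cf fE]].
    exact: Pi0_3_accepted.
  exists (fun y => (f y, alpha)); last by apply/seteqP; split=> y /fE.
  by move=> y; exact: (continuous_comp (cf y) (pair_cont (f y))).
Qed.
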